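(* Let $d,n\in\mathbb{N}$, $r>0$, $\hat\alpha=(\alpha_1,\dots,\alpha_d)\in(0,1]^d$, $A,B\in\mathbb{R}^{d\times d}$, $E\in\mathbb{R}^{d\times n}$, $C=(c_{ij})\in\mathbb{R}^{n\times d}$, $D=(d_{ij})\in\mathbb{R}^{n\times n}$, and let $\tau_k:[0,\infty)\to\mathbb{R}_{\ge0}$ ($k=1,2,3$) be continuous with $t-\tau_k(t)\ge -r$ for all $t\ge0$ and $\lim_{t\to\infty}(t-\tau_k(t))=\infty$. Suppose that $A$ is Metzler, $B,C,D,E$ are nonnegative, and $$\sum_{k=1}^d|c_{ik}|<1\quad\text{and}\quad \sum_{j=1}^n|d_{ij}|<1\qquad\text{for all } i=1,\dots,n.$$ Let $f\in C([0,\infty);\mathbb{R}^d_{\ge0})$ and $g\in C([0,\infty);\mathbb{R}^n_{\ge0})$ satisfy $\lim_{t\to\infty}f(t)=0$ and $\lim_{t\to\infty}g(t)=0$. If $A+B+E(I_n-D)^{-1}C$ is Hurwitz, then the system $$\begin{cases}{}^{C}D^{\hat\alpha}_{0^+}x(t)=Ax(t)+Bx(t-\tau_1(t))+Ey(t-\tau_2(t))+f(t), & t\in(0,\infty),\\ y(t)=Cx(t)+Dy(t-\tau_3(t))+g(t), & t\in[0,\infty),\\ x(t)=\psi(t),\ y(t)=\varphi(t), & t\in[-r,0],\end{cases}$$ is globally attractive; that is, for all $\psi\in C([-r,0];\mathbb{R}^d_{\ge0})$ and $\varphi\in C([-r,0];\mathbb{R}^n_{\ge0})$ with $C\psi(0)+D\varphi(-\tau_3(0))+g(0)=\varphi(0)$,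 its solution $\Phi(\cdot;\psi,\varphi)=(x,y)^{\rm T}$ satisfies $\lim_{t\to\infty}\|\Phi(t;\psi,\varphi)\|=0$.
   Context: For $\alpha\in(0,1]$, $I^\alpha_{0^+}u(t)=\frac{1}{\Gamma(\alpha)}\int_0^t(t-s)^{\alpha-1}u(s)\,ds$ (with $I^0_{0^+}u=u$), and the Caputo fractional derivative is ${}^{C}D^{\alpha}_{0^+}u(t)=\frac{d}{dt}I^{1-\alpha}_{0^+}(u(t)-u(0))$ for $t>0$; ${}^{C}D^{\hat\alpha}_{0^+}x(t)=({}^{C}D^{\alpha_1}_{0^+}x_1(t),\dots,{}^{C}D^{\alpha_d}_{0^+}x_d(t))^{\rm T}$. A square matrix is Metzler if its off-diagonal entries are nonnegative, and Hurwitz if all its eigenvalues have negative real part; a matrix is nonnegative if all its entries are. The solution $\Phi(\cdot;\psi,\varphi)$ is the (under the row-sum conditions, unique) continuous function $[-r,\infty)\to\mathbb{R}^{d+n}$ satisfying the equations and the initial condition. Global attractivity is spelled out in the claim in the form the paper defines it for positive systems (nonnegative inputs and nonnegative initial data produce nonnegative solutions); the system here is of this kind. *)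

(* Defs.v *)
From HB Require Import structures.
From mathcomp Require Import all_boot all_order all_algebra.
From mathcomp Require Import complex.
From mathcomp Require Import all_classical all_reals all_analysis.
Set Implicit Arguments.
Unset Strict Implicit.
Unset Printing Implicit Defensive.
Import Order.TTheory GRing.Theory Num.Theory.
Import numFieldNormedType.Exports.
Local Open Scope classical_set_scope.
Local Open Scope ring_scope.

Definition Gamma (R : realType) (a : R) : R :=
  \int[lebesgue_measure]_(t in `]0, +oo[) (t `^ (a - 1) * expR (- t)).

(* The Riemann-Liouville integral I^a_{0+}, with I^0 the identity. *)
Definition frac_integral (R : realType) (a : R) (u : R -> R) (t : R) : R :=
  if a == 0 then u t
  else (Gamma a)^-1 *
    \int[lebesgue_measure]_(s in `[0, t]) ((t - s) `^ (a - 1) * u s).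

(* The Caputo derivative of u of order a exists at t and equals v.  It is a
   relation because 'D_1 is total: an equation between values of 'D_1 would not
   say that the derivative exists. *)
Definition is_caputo (R : realType) (a : R) (u : R -> R) (t v : R) : Prop :=
  is_derive t (1 : R) (frac_integral (1 - a) (fun s => u s - u 0)) v.

Definition metzler (R : realType) (d : nat) (M : 'M[R]_d) : Prop :=
  forall i j, i != j -> 0 <= M i j.

Definition hurwitz (R : realType) (d : nat) (M : 'M[R]_d) : Prop :=
  forall z : R[i], eigenvalue (map_mx (real_complex R) M) z -> complex.Re z < 0.

Definition admissible_delay (R : realType) (r : R) (tau : R -> R) : Prop :=
  [/\ {within `[0, +oo[, continuous tau},
      forall t, 0 <= t -> 0 <= tau t,
      forall t, 0 <= t -> - r <= t - tau t &
      t - tau t @[t --> +oo] --> +oo].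

(* All functions of time are total on R; only their values on the intervals
   mentioned below matter. *)
Record coupled_system (R : realType) (d n : nat) := CoupledSystem {
  sys_r : R;
  sys_alpha : 'I_d -> R;
  sys_A : 'M[R]_d;
  sys_B : 'M[R]_d;
  sys_E : 'M[R]_(d, n);
  sys_C : 'M[R]_(n, d);
  sys_D : 'M[R]_n;
  sys_tau1 : R -> R;
  sys_tau2 : R -> R;
  sys_tau3 : R -> R;
  sys_f : R -> 'cV[R]_d;
  sys_g : R -> 'cV[R]_n
}.

Definition is_solution (R : realType) (d n : nat) (S : coupled_system R d n)
    (psi : R -> 'cV[R]_d) (phi : R -> 'cV[R]_n)
    (x : R -> 'cV[R]_d) (y : R -> 'cV[R]_n) : Prop :=
  [/\ {within `[- sys_r S, +oo[, continuous x} /\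
      {within `[- sys_r S, +oo[, continuous y},
      forall t, 0 < t -> forall i : 'I_d,
        is_caputo (sys_alpha S i) (fun s => x s i 0) t
          ((sys_A S *m x t + sys_B S *m x (t - sys_tau1 S t)
            + sys_E S *m y (t - sys_tau2 S t) + sys_f S t) i 0),
      forall t, 0 <= t ->
        y t = sys_C S *m x t + sys_D S *m y (t - sys_tau3 S t) + sys_g S t &
      forall t, - sys_r S <= t <= 0 -> x t = psi t /\ y t = phi t].

(* Global attractivity for positive systems: initial data are nonnegative and
   satisfy the compatibility condition at time 0. *)
Definition globally_attractive (R : realType) (d n : nat)
    (S : coupled_system R d n) : Prop :=
  forall (psi : R -> 'cV[R]_d) (phi : R -> 'cV[R]_n),
    {within `[- sys_r S, 0], continuous psi} ->
    {within `[- sys_r S, 0], continuous phi} ->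
    (forall t, - sys_r S <= t <= 0 -> psi t \is a mxOver Num.nneg) ->
    (forall t, - sys_r S <= t <= 0 -> phi t \is a mxOver Num.nneg) ->
    sys_C S *m psi 0 + sys_D S *m phi (- sys_tau3 S 0) + sys_g S 0 = phi 0 ->
  forall (x : R -> 'cV[R]_d) (y : R -> 'cV[R]_n),
    is_solution S psi phi x y ->
    `|col_mx (x t) (y t)| @[t --> +oo] --> (0 : R).

(* Main.v *)
Require Import Defs.
From mathcomp Require Import all_boot all_order all_algebra.
From mathcomp Require Import complex.
From mathcomp Require Import all_classical all_reals all_analysis.
From mathcomp Require Import measurable_realfun ring lra.
Import Order.TTheory GRing.Theory Num.Theory.
Import numFieldNormedType.Exports.
Local Open Scope classical_set_scope.
Local Open Scope ring_scope.

(** Why the system is attractive.  The matrix A + B + E (1 - D)^-1 C is Metzler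
    and Hurwitz, so it maps some positive vector v to a negative one.  A small
    perturbation of (1 - D)^-1 C v completes v to a pair of positive vectors v, w
    such that (A + B) v + E w <= - e and C v + D w <= w - e entrywise for some
    e > 0 ([comparison_vectors]).  Call m a level at time t when x t <= m v and
    y t <= m w entrywise.

    Fractional dynamics enter only through a maximum principle
    ([caputo_max_principle]): if u(t) + c t is larger at time T than at time
    0, then at some time t <= T this function is nearly as large as at T and
    the Caputo derivative of u is at least - c kappa T^(1-a). With c = 0 it
    bounds the solution from above: at a point where some normalized component
    attains a new maximal level m, the right-hand side is at most - m e plus
    the forcing, which is negative when m is large; a component of y cannot
    attain it either, because its equation gives at most m (w - e) plus the
    forcing ([solution_bounded_above]). With c = N / L and L large it shows
    that a component cannot stay above a threshold above which its derivative
    is bounded away from 0 by a negative constant: it is compared on [0, L]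
    with a line that descends so slowly that its fractional derivative is
    negligible ([caputo_eventually_le]). Since the delayed times tend to
    infinity and the forcing vanishes, a level m > 0 valid from some time on
    can therefore be lowered to theta m, with theta < 1 independent of m
    ([dominated_contraction]); iterating, the upper limits of all components
    are at most 0. The equations are linear, so the same bound for the
    opposite solution, which has the opposite forcing, gives convergence to 0.

    The maximum principle is delicate because u is only continuous, while its
    derivative is that of a singular convolution.  It is proved by averaging:
    the increment over a step e of the fractional integral of u is the
    convolution of the kernel s^(-a) with u(t - s) - u(t - e - s), which is the
    derivative of the moving integral of u over windows of length e.  At a
    maximum of this C^1 function the convolution has the right sign, because the
    kernel decreases ([powR_kernel_ge0]); the mean value theorem then yields a
    point of the window at which the Caputo derivative has this sign. *)

Set Implicit Arguments.
Unset Strict Implicit.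
Unset Printing Implicit Defensive.

(** * Metzler matrices and comparison vectors *)

(** The minimum of the ratios x_i / v_i is attained at some k; if it were
    negative, the row k of P x would be at most that ratio times the row k of P v. *)
Lemma zmatrix_monotone (R : realType) (n : nat) (P : 'M[R]_n) (v x : 'cV[R]_n) :
  (forall i j, i != j -> P i j <= 0) ->
  (forall i, 0 < v i 0) -> (forall i, 0 < (P *m v) i 0) ->
  (forall i, 0 <= (P *m x) i 0) -> forall i, 0 <= x i 0.
Proof.
move=> Pz v0 Pv0 Px0 i; rewrite leNgt; apply/negP => xi0.
have [k _ kmin] :=
  @Order.TotalTheory.arg_minP _ _ _ i predT (fun j => x j 0 / v j 0) isT.
set rho := x k 0 / v k 0 in kmin.
have rho0 : rho < 0.
  apply: le_lt_trans (kmin i isT) _.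
  by rewrite pmulr_llt0// invr_gt0.
have xj j : rho * v j 0 <= x j 0.
  by rewrite -ler_pdivlMr// kmin.
have : (P *m x) k 0 <= rho * (P *m v) k 0.
  rewrite !mxE mulr_sumr; apply: ler_sum => j _.
  have [->|kj] := eqVneq j k.
    by rewrite mulrCA /rho divfK// gt_eqF.
  by rewrite mulrCA ler_wnM2l// Pz// eq_sym.
apply/negP; rewrite -ltNge; apply: lt_le_trans (Px0 k).
by rewrite pmulr_llt0.
Qed.

Lemma zmatrix_unit (R : realType) (n : nat) (P : 'M[R]_n) (v : 'cV[R]_n) :
  (forall i j, i != j -> P i j <= 0) ->
  (forall i, 0 < v i 0) -> (forall i, 0 < (P *m v) i 0) -> P \in unitmx.
Proof.
move=> Pz v0 Pv0.
rewrite -unitmx_tr -row_free_unit -kermx_eq0; apply/rowV0P => w /sub_kermxP wP.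
have Pw : P *m w^T = 0.
  by rewrite -[LHS]trmxK trmx_mul trmxK wP trmx0.
apply/matrixP => a i; rewrite ord1 [RHS]mxE; apply/eqP; rewrite eq_le.
have := @zmatrix_monotone R n P v w^T Pz v0 Pv0.
have := @zmatrix_monotone R n P v (- w^T) Pz v0 Pv0.
rewrite mulmxN Pw => h1 h2.
have := h1 _ i; have := h2 _ i; rewrite !mxE oppr_ge0 => -> //; last first.
  by move=> j; rewrite mxE.
by move=> -> // j; rewrite !mxE oppr0.
Qed.

(** A singular shift by s >= 0 would make s a nonnegative real eigenvalue. *)
Lemma hurwitz_shift_unit (R : realType) (n : nat) (M : 'M[R]_n) (s : R) :
  hurwitz M -> 0 <= s -> s%:M - M \in unitmx.
Proof.
move=> hM s0; apply: contraT => sing.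
have : eigenvalue (map_mx (real_complex R) M) (real_complex R s).
  rewrite eigenvalue_root_char -map_char_poly fmorph_root -eigenvalue_root_char.
  rewrite /eigenvalue /eigenspace kermx_eq0 row_free_unit.
  by rewrite -opprB -scaleN1r unitmxZ ?unitrN1.
by move=> /hM /=; rewrite ltNge s0.
Qed.

(** The stability criterion for Metzler matrices.  Let s0 be the infimum of the
    shifts s >= 0 for which s - M maps some positive vector to a positive one.
    The vector (s0 - M)^-1 1 is itself such a witness at s0: it is nonnegative by
    monotonicity of s - M for admissible s close to s0, and the diagonal terms
    make it positive.  The condition being open in s, this forces s0 = 0,
    and the witness at 0 is the vector sought. *)
Lemma metzler_hurwitz_positive (R : realType) (n : nat) (M : 'M[R]_n) :
  metzler M -> hurwitz M ->
  exists2 v : 'cV[R]_n, (forall i, 0 < v i 0) & (forall i, (M *m v) i 0 < 0).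
Proof.
move=> metM hM.
have offdiag s i j : i != j -> (s%:M - M) i j <= 0.
  by move=> ij; rewrite !mxE (negPf ij) mulr0n sub0r oppr_le0 metM.
have shiftE s (v : 'cV[R]_n) i :
    ((s%:M - M) *m v) i 0 = s * v i 0 - (M *m v) i 0.
  by rewrite mulmxBl mul_scalar_mx !mxE.
pose S := [set s : R | 0 <= s /\ exists2 v : 'cV[R]_n,
  (forall i, 0 < v i 0) & (forall i, 0 < ((s%:M - M) *m v) i 0)].
have S0 : S !=set0.
  exists (1 + \sum_i \sum_j `|M i j|); split.
    by rewrite addr_ge0// sumr_ge0// => i _; rewrite sumr_ge0.
  exists (const_mx 1) => i; first by rewrite mxE.
  rewrite shiftE !mxE mulr1 subr_gt0 ltr_pwDl//.
  rewrite [leRHS](bigD1 i)//= ler_wpDr//.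
    by rewrite sumr_ge0// => k _; rewrite sumr_ge0.
  by apply: ler_sum => j _; rewrite mxE mulr1 ler_norm.
have lbS : lbound S 0 by move=> s [].
have infS : has_inf S by split => //; exists 0.
pose s0 := inf S.
have s0ge0 : 0 <= s0 by apply: lb_le_inf.
pose v0 := invmx (s0%:M - M) *m (const_mx 1 : 'cV[R]_n).
have v0E i : ((s0%:M - M) *m v0) i 0 = 1.
  by rewrite /v0 mulKVmx ?hurwitz_shift_unit// mxE.
pose e := (1 + \sum_i `|v0 i 0|)^-1.
have sum0 : 0 <= \sum_i `|v0 i 0| by rewrite sumr_ge0.
have e0 : 0 < e by rewrite invr_gt0; lra.
have ev i : e * `|v0 i 0| < 1.
  rewrite /e mulrC ltr_pdivrMr ?mul1r; last by lra.
  by rewrite (bigD1 i)//= addrCA ltr_pwDr// ltr_wpDr// sumr_ge0.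
have [s [sge0 [v vpos Pv]] slt] := inf_adherent e0 infS.
have s0s : s0 <= s by apply: ge_inf; [exists 0|split => //; exists v].
have v0ge0 : forall i, 0 <= v0 i 0.
  apply: (zmatrix_monotone (offdiag s) vpos Pv) => i.
  have : ((s%:M - M) *m v0) i 0 = 1 + (s - s0) * v0 i 0.
    by rewrite -(v0E i) !shiftE; ring.
  move=> ->.
  have : (s - s0) * `|v0 i 0| <= e * `|v0 i 0|.
    by rewrite ler_wpM2r//; rewrite -/s0 in slt; lra.
  have : (s - s0) * - v0 i 0 <= (s - s0) * `|v0 i 0|.
    by rewrite ler_wpM2l ?subr_ge0// -normrN ler_norm.
  by have := ev i; lra.
have v0pos i : 0 < v0 i 0.
  rewrite lt_def v0ge0 andbT; apply/eqP => v0i.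
  have := v0E i; rewrite shiftE v0i mulr0 sub0r mxE => /eqP.
  rewrite eq_sym -subr_eq0 opprK => /eqP E.
  suff : 0 <= \sum_j M i j * v0 j 0 by lra.
  apply: sumr_ge0 => j _.
  have [<-|ij] := eqVneq i j; first by rewrite v0i mulr0.
  by rewrite mulr_ge0// metM.
have [s00|s0N0] := eqVneq s0 0.
  exists v0 => // i; have := v0E i; rewrite shiftE s00 mul0r; lra.
have s0gt0 : 0 < s0 by rewrite lt_def s0N0.
pose e' := Num.min e s0.
have e'0 : 0 < e' by rewrite lt_min e0.
suff : s0 <= s0 - e' by lra.
apply: ge_inf; first by exists 0.
split; first by rewrite subr_ge0 ge_min lexx orbT.
exists v0 => // i.
have -> : (((s0 - e')%:M - M) *m v0) i 0 = 1 - e' * v0 i 0.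
  by rewrite -(v0E i) !shiftE; ring.
have : e' * v0 i 0 <= e * v0 i 0 by rewrite ler_wpM2r// ge_min lexx.
by have := ev i; rewrite ger0_norm//; lra.
Qed.

(** The strict inequality M v < 0 leaves room to replace w = (1 - D)^-1 C v by
    (1 - D)^-1 (C v + e 1), which makes the second inequality strict too. *)
Lemma comparison_vectors (R : realType) (d n : nat) (A B : 'M[R]_d)
    (E : 'M[R]_(d, n)) (C : 'M[R]_(n, d)) (D : 'M[R]_n) :
  metzler A -> (forall i j, 0 <= B i j) -> (forall i j, 0 <= E i j) ->
  (forall i j, 0 <= C i j) -> (forall i j, 0 <= D i j) ->
  (forall i, \sum_j D i j < 1) ->
  hurwitz (A + B + E *m invmx (1%:M - D) *m C) ->
  exists (v : 'cV[R]_d) (w : 'cV[R]_n) (e : R),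
    [/\ (forall i, 0 < v i 0), (forall j, 0 < w j 0), 0 < e,
        (forall i, (A *m v + B *m v + E *m w) i 0 <= - e) &
        (forall j, (C *m v + D *m w) j 0 <= w j 0 - e)].
Proof.
move=> metA B0 E0 C0 D0 Drow hH.
pose P : 'M[R]_n := 1%:M - D.
have PE (w : 'cV[R]_n) j : (P *m w) j 0 = w j 0 - (D *m w) j 0.
  by rewrite mulmxBl mul1mx !mxE.
have Poff i j : i != j -> P i j <= 0.
  by move=> ij; rewrite !mxE (negPf ij) sub0r oppr_le0.
have one0 i : 0 < (const_mx 1 : 'cV[R]_n) i 0 by rewrite mxE.
have P1 i : 0 < (P *m (const_mx 1 : 'cV[R]_n)) i 0.
  rewrite PE !mxE subr_gt0; under eq_bigr do rewrite mxE mulr1.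
  exact: Drow.
have Pu : P \in unitmx := zmatrix_unit Poff one0 P1.
have Pinv0 (x : 'cV[R]_n) : (forall i, 0 <= x i 0) ->
    forall i, 0 <= (invmx P *m x) i 0.
  move=> x0; apply: (zmatrix_monotone Poff one0 P1) => i.
  by rewrite mulKVmx.
have PinvE i j : 0 <= invmx P i j.
  have d0 k : 0 <= (delta_mx j 0 : 'cV[R]_n) k 0 by rewrite mxE ler0n.
  by have := Pinv0 _ d0 i; rewrite -colE mxE.
set M := (X in hurwitz X) in hH.
have metM : metzler M.
  move=> i j ij; rewrite !mxE addr_ge0 ?addr_ge0 ?metA// sumr_ge0// => k _.
  by rewrite mulr_ge0// !mxE sumr_ge0// => l _; rewrite mulr_ge0.
have [v v0 Mv] := metzler_hurwitz_positive metM hH.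
pose q : 'cV[R]_n := invmx P *m const_mx 1.
have q0 i : 0 <= q i 0 by apply: Pinv0 => k; rewrite mxE.
have Eq0 i : 0 <= (E *m q) i 0.
  by rewrite mxE sumr_ge0// => k _; rewrite mulr_ge0.
(* e is small enough for - M v to absorb the perturbation e *: (E *m q) *)
have [e e0 He] : exists2 e : R, 0 < e &
    forall i, e + e * (E *m q) i 0 <= - (M *m v) i 0.
  pose Z := \sum_i (1 + (E *m q) i 0) / - (M *m v) i 0.
  have term i : 0 < (1 + (E *m q) i 0) / - (M *m v) i 0.
    by rewrite divr_gt0 ?oppr_gt0// ltr_pwDl.
  have Z0 : 0 <= Z by rewrite sumr_ge0// => i _; rewrite ltW.
  exists (1 + Z)^-1; first by rewrite invr_gt0; lra.
  move=> i; rewrite -{1}[_^-1]mulr1 -mulrDr ler_pdivrMl; last by lra.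
  rewrite -ler_pdivrMr ?oppr_gt0// /Z (bigD1 i)//= addrCA ler_wpDr//.
  by rewrite addr_ge0// sumr_ge0// => k _; rewrite ltW.
pose w : 'cV[R]_n := invmx P *m (C *m v) + e *: q.
have PwE : P *m w = C *m v + e *: const_mx 1.
  by rewrite mulmxDr mulKVmx// -scalemxAr mulKVmx.
have Cv0 j : 0 <= (C *m v) j 0.
  by rewrite mxE sumr_ge0// => k _; rewrite mulr_ge0// ltW.
have w0 j : 0 <= w j 0.
  by rewrite mxE addr_ge0 ?Pinv0// mxE mulr_ge0// ltW.
have wE j : w j 0 = (C *m v + D *m w) j 0 + e.
  have : (P *m w) j 0 = (C *m v) j 0 + e.
    by rewrite PwE !mxE mulr1.
  by rewrite PE => PwEj; rewrite [(_ + _ : 'cV_n) j 0]mxE; lra.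
exists v, w, e; split => //.
- move=> j; rewrite wE ltr_wpDl// mxE addr_ge0// mxE.
  by rewrite sumr_ge0// => k _; rewrite mulr_ge0.
- move=> i.
  have -> : A *m v + B *m v + E *m w = M *m v + e *: (E *m q).
    by rewrite /M /w mulmxDr !mulmxDl -!scalemxAr !mulmxA addrA.
  have -> : (M *m v + e *: (E *m q)) i 0 = (M *m v) i 0 + e * (E *m q) i 0.
    by rewrite mxE [X in _ + X]mxE.
  by have := He i; lra.
- by move=> j; rewrite [X in _ <= X - _]wE addrK.
Qed.

(** * The kernel s^(b-1) and reflection of integrals *)

Lemma continuous_powR (R : realType) (a x : R) :
  0 < x -> {for x, continuous (fun s : R => s `^ a)}.
Proof.
move=> x0; apply/differentiable_continuous/derivable1_diffP.
by apply: derivable_powR; rewrite in_itv/= x0.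
Qed.

Lemma integral_powR (R : realType) (b h t : R) : 0 < b -> 0 < h -> h < t ->
  (\int[lebesgue_measure]_(s in `[h, t]) (s `^ (b - 1))%:E =
   (b^-1 * t `^ b)%:E - (b^-1 * h `^ b)%:E)%E.
Proof.
move=> b0 h0 ht.
have dF (x : R) : 0 < x ->
    is_derive x 1 (fun s : R => b^-1 * s `^ b) (x `^ (b - 1)).
  move=> x0.
  have := is_deriveZ (b^-1) (is_derive1_powR b x0).
  by move=> H; apply: is_derive_eq; rewrite -[_ *: _]/(_ * _) mulrA mulVf ?mul1r// gt_eqF.
have cF (x : R) : 0 < x -> {for x, continuous (fun s : R => b^-1 * s `^ b)}.
  move=> x0; apply/differentiable_continuous/derivable1_diffP.
  by have [] := dF x x0.
apply: (@continuous_FTC2 _ _ (fun s : R => b^-1 * s `^ b)) => //.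
- apply: derivable_within_continuous => x; rewrite in_itv/= => /andP[hx _].
  by apply: derivable_powR; rewrite in_itv/= (lt_le_trans h0).
- split.
  + move=> x; rewrite in_itv/= => /andP[hx _].
    by have [] := dF x (lt_trans h0 hx).
  + exact/cvg_at_right_filter/cF.
  + exact/cvg_at_left_filter/cF/(lt_trans h0).
- move=> x; rewrite in_itv/= => /andP[hx _].
  by rewrite derive1E; have [_ ->] := dF x (lt_trans h0 hx).
Qed.

(** The antiderivative s^b / b is used on [h, t] only, and h tends to 0. *)
Lemma integral_powR0_le (R : realType) (b t : R) : 0 < b -> 0 < t ->
  (\int[lebesgue_measure]_(s in `[0%R, t]) (s `^ (b - 1))%:E <=
   (b^-1 * t `^ b)%:E)%E.
Proof.
move=> b0 t0.
have mf (D : set R) : measurable_fun D (fun s : R => s `^ (b - 1)).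
  by apply: measurable_funTS; exact: measurable_powR.
rewrite -integral_itv_obnd_cbnd; last exact/measurable_EFinP.
pose F (i : nat) : set R := `[t / i.+2%:R, t]%classic.
have -> : `]0, t]%classic = \bigcup_i F i.
  apply/seteqP; split => x /=.
    rewrite in_itv/= => /andP[x0 xt].
    exists (Num.truncn (t / x)) => //; rewrite /F/= in_itv/= xt andbT.
    rewrite ler_pdivrMr// mulrC -ler_pdivrMr// ltW//.
    by rewrite (lt_trans (Num.Theory.truncnS_gt _))// ltr_nat.
  move=> [i _]; rewrite /F/= !in_itv/= => /andP[h ->]; rewrite andbT.
  by rewrite (lt_le_trans _ h)// divr_gt0.
have nd : nondecreasing_seq F.
  move=> i j ij; apply/subsetPset => x; rewrite /F/= !in_itv/= => /andP[h ->].
  rewrite andbT (le_trans _ h)// ler_pM2l// lef_pV2 ?posrE//.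
  by rewrite ler_nat !ltnS.
have cv : ((\int[lebesgue_measure]_(s in F i) (s `^ (b - 1))%:E) @[i --> \oo] -->
    \int[lebesgue_measure]_(s in \bigcup_i F i) (s `^ (b - 1))%:E)%E.
  apply: ge0_nondecreasing_set_cvg_integral => //.
  - by move=> i; exact: measurable_itv.
  - by move=> i; apply/measurable_EFinP; exact: mf.
  - by move=> i x _; rewrite lee_fin powR_ge0.
rewrite -(cvg_lim _ cv)//; apply: lime_le; first by apply/cvg_ex; eexists; exact: cv.
near=> i; rewrite integral_powR//.
- by rewrite -EFinB lee_fin gerBl mulr_ge0 ?powR_ge0// invr_ge0 ltW.
- by rewrite divr_gt0.
- by rewrite ltr_pdivrMr// ltr_pMr// ltr1n.
Unshelve. all: by end_near. Qed.

Lemma integrable_powR (R : realType) (b t : R) : 0 < b -> 0 < t ->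
  (@lebesgue_measure R).-integrable `[0, t] (fun s : R => (s `^ (b - 1))%:E).
Proof.
move=> b0 t0; apply/integrableP; split.
  by apply/measurable_EFinP; apply: measurable_funTS; exact: measurable_powR.
under eq_integral do rewrite gee0_abs ?lee_fin ?powR_ge0//.
by rewrite (le_lt_trans (integral_powR0_le b0 t0))// ltry.
Qed.

Lemma Rintegral_powR_le (R : realType) (b t : R) : 0 < b -> 0 < t ->
  \int[lebesgue_measure]_(s in `[0, t]) (s `^ (b - 1)) <= b^-1 * t `^ b.
Proof.
move=> b0 t0; rewrite -lee_fin fineK ?integral_powR0_le//.
exact: integrable_fin_num (integrable_powR b0 t0).
Qed.

Lemma bounded_within_segment (R : realType) (V : normedModType R) (a b : R)
    (u : R -> V) :
  {within `[a, b], continuous u} ->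
  exists2 M, 0 < M & forall s, a <= s <= b -> `|u s| <= M.
Proof.
move=> cu; have := compact_bounded (continuous_compact cu (@segment_compact R a b)).
move=> [M [_ hM]]; exists (`|M| + 1); first by rewrite ltr_wpDl.
move=> s sab; apply: (hM (`|M| + 1)); first by rewrite ltr_pwDr// ler_norm.
by exists s.
Qed.

Lemma integrable_powR_continuous (R : realType) (b t : R) (u : R -> R) :
  0 < b -> 0 < t -> {within `[0, t], continuous u} ->
  (@lebesgue_measure R).-integrable `[0, t]
    (EFin \o (fun s : R => s `^ (b - 1) * u s)).
Proof.
move=> b0 t0 cu.
have bu : [bounded u x | x in `[0, t]%classic].
  have [M M0 uM] := bounded_within_segment cu.
  exists M; split => [|K MK s /= sab]; first exact: num_real.
  by rewrite (le_trans (uM _ sab))// ltW.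
rewrite (_ : EFin \o _ = ((fun s : R => (s `^ (b - 1))%:E) \* (EFin \o u))%E)//.
apply: integrableMl => //.
  exact: integrable_powR.
exact: subspace_continuous_measurable_fun.
Qed.

Lemma lebesgue_measure_reflect (R : realType) (t : R) (A : set R) :
  measurable A ->
  pushforward lebesgue_measure ((fun s => t - s) : _ -> measurableTypeR R) A =
  lebesgue_measure A.
Proof.
move=> mA; apply/esym/lebesgue_measure_unique => //=; first exact: measurable_funB.
move=> _ _ [[a b]] _ <-; rewrite /pushforward.
have -> : (fun s : R => t - s) @^-1` `]a, b] = `[t - b, t - a[%classic.
  by apply/seteqP; split => x /=; rewrite !in_itv/= => /andP[? ?];
    apply/andP; split; lra.
rewrite !lebesgue_measure_itv/= !lte_fin ltrD2l ltrN2.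
by case: ifP => // _; congr (_%:E); rewrite opprB addrACA; ring.
Qed.

(** The change of variables goes through the invariance of the measure, since
    the substitution rules for antiderivatives ask for a continuous integrand. *)
Lemma Rintegral_reflect (R : realType) (t : R) (f : R -> R) :
  measurable_fun `[0, t] f ->
  \int[lebesgue_measure]_(s in `[0, t]) f (t - s) =
  \int[lebesgue_measure]_(s in `[0, t]) f s.
Proof.
move=> mf.
have mphi : measurable_fun [set: measurableTypeR R]
    ((fun s => t - s) : measurableTypeR R -> measurableTypeR R).
  exact: measurable_funB.
have preim : (fun s : R => t - s) @^-1` `[0, t] = `[0, t]%classic.
  by apply/seteqP; split => x /=; rewrite !in_itv/= => /andP[? ?];
    apply/andP; split; lra.
have key (g : R -> \bar R) : measurable_fun `[0, t] g -> (forall s, 0 <= g s)%E ->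
    (\int[lebesgue_measure]_(s in `[0%R, t]) g (t - s)%R =
    \int[lebesgue_measure]_(s in `[0%R, t]) g s)%E.
  move=> mg g0.
  transitivity (\int[pushforward lebesgue_measure
      ((fun s => t - s)%R : _ -> measurableTypeR R)]_(s in `[0%R, t]) g s)%E.
    by rewrite (ge0_integral_pushforward mphi)// preim.
  by apply: eq_measure_integral => A mA _; exact: lebesgue_measure_reflect.
rewrite /Rintegral; congr fine; rewrite integralE [RHS]integralE.
congr (_ - _)%E.
- rewrite -[RHS]key//; last by apply: measurable_funepos; exact/measurable_EFinP.
  by rewrite unlock.
- rewrite -[RHS]key//; last by apply: measurable_funeneg; exact/measurable_EFinP.
  by rewrite unlock.
Qed.

(** When the positive and the negative part of f both have an infinite integral,
    both sides are 0. *)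
Lemma RintegralN (R : realType) (D : set R) (f : R -> R) :
  \int[lebesgue_measure]_(s in D) (- f s) = - \int[lebesgue_measure]_(s in D) f s.
Proof.
rewrite /Rintegral integralE [in RHS]integralE.
have -> : (fun s : R => (- f s)%:E) = (\- (EFin \o f))%E by [].
rewrite funeposN funenegN.
move: (integral _ _ _) (integral _ _ _) => [p| |] [q| |]; rewrite ?oppr0//=.
by rewrite opprB.
Qed.

(** Integration by parts turns the integral into the boundary term
    t^(b-1) V(t) plus the integral of (1 - b) s^(b-2) V(s), both nonnegative.
    The kernel being singular at 0, this is done on [h, t], with an error of
    order h^b. *)
Lemma powR_kernel_ge0 (R : realType) (b t : R) (v V : R -> R) :
  0 < b <= 1 -> 0 < t -> {within `[0, t], continuous v} ->
  (forall s, 0 <= s <= t -> is_derive s 1 V (v s)) ->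
  V 0 = 0 -> (forall s, 0 <= s <= t -> 0 <= V s) ->
  0 <= \int[lebesgue_measure]_(s in `[0, t]) (s `^ (b - 1) * v s).
Proof.
move=> /andP[b0 b1] t0 cv dV V0 Vge0.
have cV s : 0 <= s <= t -> {for s, continuous V}.
  move=> st; apply/differentiable_continuous/derivable1_diffP.
  by have [] := dV s st.
have [M M0 vM] := bounded_within_segment cv.
have VM h : 0 < h <= t -> V h <= M * h.
  move=> /andP[h0 ht].
  have [||c + E] := @MVT _ V v 0 h h0.
  - move=> x; rewrite in_itv/= => /andP[x0 xh]; apply: dV; lra.
  - apply: continuous_in_subspaceT => x; rewrite inE/= in_itv/= => /andP[x0 xh].
    by apply: cV; lra.
  rewrite in_itv/= => /andP[c0 ch]; rewrite -[V h]subr0 -V0 E subr0 ler_wpM2r//.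
    exact: ltW.
  by apply: le_trans (ler_norm _) (vM _ _); lra.
set I := (X in 0 <= X).
have integ h : 0 < h <= t -> (@lebesgue_measure R).-integrable `[0, h]
    (EFin \o (fun s : R => s `^ (b - 1) * v s)).
  move=> /andP[h0 ht]; apply: integrable_powR_continuous => //.
  apply: continuous_subspaceW cv; apply: subset_itvl; by rewrite bnd_simp.
(* cut the singularity off on [0, h] and integrate by parts on [h, t] *)
have key h : 0 < h < t -> - (M * (1 + b^-1) * h `^ b) <= I.
  move=> /andP[h0 ht].
  have near0 : - (M * b^-1 * h `^ b) <=
      \int[lebesgue_measure]_(s in `[0, h]) (s `^ (b - 1) * v s).
    apply: (@le_trans _ _
      (\int[lebesgue_measure]_(s in `[0, h]) (- M * s `^ (b - 1)))).
      rewrite RintegralZl//; last exact: integrable_powR.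
      rewrite mulNr lerN2 -mulrA ler_pM2l//; exact: Rintegral_powR_le.
    apply: le_Rintegral => //.
    - have := @integrableZl _ _ _ lebesgue_measure `[0, h]%classic
        (measurable_itv _) (- M) _ (integrable_powR b0 h0).
      by apply: eq_integrable.
    - by apply: integ; lra.
    - move=> s; rewrite /= in_itv/= => /andP[s0 sh].
      rewrite mulrC ler_wpM2l ?powR_ge0//.
      have := vM s; rewrite ler_norml => /(_ _)/andP[]//; lra.
  have away : - (M * h `^ b) <=
      \int[lebesgue_measure]_(s in `[h, t]) (s `^ (b - 1) * v s).
    pose df (s : R) := (b - 1) * s `^ (b - 1 - 1).
    have dp (s : R) : 0 < s -> is_derive s 1 (fun s : R => s `^ (b - 1)) (df s).
      exact: is_derive1_powR.
    have cp (s : R) : 0 < s -> {for s, continuous (fun s : R => s `^ (b - 1))}.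
      exact: continuous_powR.
    rewrite (@Rintegration_by_parts _ (fun s : R => s `^ (b - 1)) V df v)//.
    - have VtP : 0 <= t `^ (b - 1) * V t.
        by rewrite mulr_ge0 ?powR_ge0// Vge0; lra.
      have VhP : h `^ (b - 1) * V h <= M * h `^ b.
        rewrite -(mulr_powRB1 (ltW h0) b0) [M * _]mulrA mulrC.
        by rewrite ler_wpM2r ?powR_ge0// VM; lra.
      have : \int[lebesgue_measure]_(x in `[h, t]) (df x * V x) <= 0.
        rewrite -oppr_ge0 -RintegralN Rintegral_ge0// => s.
        rewrite /= in_itv/= => /andP[s0 st].
        rewrite oppr_ge0 mulr_le0_ge0//; last by apply: Vge0; lra.
        by rewrite mulr_le0_ge0 ?powR_ge0//; lra.
      lra.
    - apply: continuous_in_subspaceT => x; rewrite inE/= in_itv/= => /andP[xh xt].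
      apply: cvgM; first exact: cvg_cst.
      by apply: continuous_powR; lra.
    - split.
      + by move=> x; rewrite in_itv/= => /andP[xh xt]; have [] := dp x (lt_trans h0 xh).
      + exact/cvg_at_right_filter/cp.
      + by apply/cvg_at_left_filter/cp; lra.
    - move=> x; rewrite in_itv/= => /andP[xh xt].
      by rewrite derive1E; have [_ ->] := dp x (lt_trans h0 xh).
    - apply: continuous_subspaceW cv; apply: subset_itvr; rewrite bnd_simp; lra.
    - split.
      + move=> x; rewrite in_itv/= => /andP[xh xt].
        have xt' : 0 <= x <= t by lra.
        by have [] := dV x xt'.
      + by apply/cvg_at_right_filter/cV; lra.
      + by apply/cvg_at_left_filter/cV; lra.
    - move=> x; rewrite in_itv/= => /andP[xh xt].
      have xt' : 0 <= x <= t by lra.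
      by rewrite derive1E; have [_ ->] := dV x xt'.
  have split : I - \int[lebesgue_measure]_(s in `[0, h]) (s `^ (b - 1) * v s) =
      \int[lebesgue_measure]_(s in `[h, t]) (s `^ (b - 1) * v s).
    rewrite /I (Rintegral_itvB (integ t _)) ?bnd_simp; [|lra..].
    rewrite Rintegral_itv_obnd_cbnd//.
    apply: integrableS (integ t _) => //; last by lra.
    by apply: subset_itvr; rewrite bnd_simp; lra.
  have -> : M * (1 + b^-1) * h `^ b = M * h `^ b + M * b^-1 * h `^ b by ring.
  lra.
rewrite leNgt; apply/negP => I0.
have c0 : 0 < M * (1 + b^-1) by rewrite mulr_gt0// addr_gt0// invr_gt0.
have small : \forall h \near (0:R)^'+, h `^ b < - I / (M * (1 + b^-1)).
  have := powR_cvg0 b0 => /cvgr_lt; apply.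
  by rewrite divr_gt0// oppr_gt0.
near (0:R)^'+ => h.
have h0 : 0 < h by near: h; exact: nbhs_right_gt.
have ht : h < t by near: h; exact: nbhs_right_lt.
have hb : h `^ b < - I / (M * (1 + b^-1)) by near: h.
have := key h; rewrite h0 ht => /(_ isT); apply/negP; rewrite -ltNge.
by move: hb; rewrite ltr_pdivlMr// mulrC; lra.
Unshelve. all: by end_near. Qed.

(** * Uniform continuity, clipping and antiderivatives *)

Lemma uniform_continuity_segment (R : realType) (u : R -> R) (a b eta : R) :
  continuous u -> 0 < eta ->
  exists2 e, 0 < e & forall s s', a <= s <= b -> `|s - s'| <= e ->
    `|u s - u s'| <= eta.
Proof.
move=> cu eta0.
have := (@compact_near_coveringP R `[a, b]).1 (@segment_compact R a b).
move=> /(_ R (0^'+) (fun e s => forall s', `|s - s'| <= e -> `|u s - u s'| <= eta) _).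
case=> [x _|rho /= rho0 H].
  have eta2 : 0 < eta / 2 by rewrite divr_gt0.
  have /cvgrPdist_lt /(_ _ eta2) [r /= r0 xr] := cu x.
  exists (ball x (r / 2), [set e | e < r / 2]) => /=.
    split; first by apply: nbhsx_ballx; rewrite divr_gt0.
    by apply: nbhs_right_lt; rewrite divr_gt0.
  move=> [y e] /= [xy er] s' ys'.
  have h1 : `|u x - u y| < eta / 2.
    by apply: xr; apply: lt_trans xy _; rewrite ltr_pdivrMr// ltr_pMr// ltr1n.
  have h2 : `|u x - u s'| < eta / 2.
    apply: xr => /=; rewrite -(subrKA y) (le_lt_trans (ler_normD _ _))//.
    by rewrite (splitr r) ltrD// (le_lt_trans ys').
  rewrite -(subrKA (u x)) (le_trans (ler_normD _ _))// distrC.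
  by rewrite (splitr eta) lerD// ltW.
exists (rho / 2); first by rewrite divr_gt0.
move=> s s' sab; apply: H; rewrite ?divr_gt0//=.
by rewrite sub0r normrN gtr0_norm ?divr_gt0// ltr_pdivrMr// ltr_pMr// ltr1n.
Qed.

(** Freezing a function on the half-line at its value at 0 gives a globally
    continuous function, for which window averages near 0 make sense. *)
Lemma continuous_clip (R : realType) (u : R -> R) :
  {within `[0, +oo[, continuous u} -> continuous (fun s : R => u (Num.max s 0)).
Proof.
move=> cu x.
have mx y : `[0, +oo[%classic (Num.max y 0 : R).
  by rewrite /= in_itv/= andbT le_max lexx orbT.
have cmax : {for x, continuous (fun y : R => Num.max y 0)}.
  by apply: continuous_max; [exact: cvg_id|exact: cvg_cst].
move=> A /(cu (Num.max x 0)) nA.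
have [V nV UV] := (nbhs_subspace_ex _ (mx x)).1 nA.
have /filterS : nbhs x ((fun y : R => Num.max y 0) @^-1` V) := cmax _ nV.
apply => y /= Vy; by have [] : (u @^-1` A `&` `[0, +oo[) (Num.max y 0) by rewrite UV.
Qed.

Lemma is_derive_integral (R : realType) (z : R -> R) (a x : R) :
  continuous z -> a < x ->
  is_derive x 1 (fun y => \int[lebesgue_measure]_(s in `[a, y]) z s) (z x).
Proof.
move=> cz ax.
have x1 : x < x + 1 by rewrite ltrDl.
have int1 : (@lebesgue_measure R).-integrable `[a, x + 1] (EFin \o z).
  apply: continuous_compact_integrable; first exact: segment_compact.
  exact: continuous_subspaceT.
have [d1 d2] := continuous_FTC1_closed x1 int1 ax (cz x).
by split; [exact: d1|rewrite -derive1E; exact: d2].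
Qed.

(** * A maximum principle for the Caputo derivative *)

(** Since w vanishes on the negative axis, the convolution at time t - e can be
    written with the integration range of the convolution at time t. *)
Lemma kernel_convolution_shift (R : realType) (b e t : R) (w : R -> R) :
  0 <= e -> continuous w -> (forall s : R, s <= 0 -> w s = 0) ->
  \int[lebesgue_measure]_(s in `[0, t - e]) ((t - e - s) `^ (b - 1) * w s) =
  \int[lebesgue_measure]_(s in `[0, t]) (s `^ (b - 1) * w (t - e - s)).
Proof.
move=> e0 cw w0.
transitivity (\int[lebesgue_measure]_(s in `[0, t - e])
    (s `^ (b - 1) * w (t - e - s))); last first.
  rewrite Rintegral_mkcond [RHS]Rintegral_mkcond; apply: eq_Rintegral => s _.
  rewrite /patch !mem_setE !in_itv/=.
  have [s0|//] := boolP (0 <= s); rewrite /=.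
  have [ste|ste] := leP s (t - e); first by rewrite (_ : s <= t)//; lra.
  by case: ifP => // _; rewrite w0 ?mulr0//; lra.
rewrite -Rintegral_reflect; last first.
  apply: measurable_funM; last first.
    by apply: measurable_funTS; exact: continuous_measurable_fun.
  apply: measurable_funTS.
  apply: (@measurableT_comp _ _ _ _ _ _ (@powR R ^~ (b - 1))) => //.
  exact: measurable_funB.
by apply: eq_Rintegral => s _; rewrite subKr.
Qed.

(** The time t maximizes over [0, T] the integral U(t) of z over [t - e, t].  The
    increment of J over [t - e, t] is, up to the contribution of the slope c, the
    convolution of the kernel with the derivative of U, to which [powR_kernel_ge0]
    applies.  The points s and s' come from the mean value theorem applied to the
    two windows: they record that z is almost maximal somewhere on the window
    ending at t. *)
Lemma riemann_liouville_increment (R : realType) (b e T c : R) (w : R -> R) :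
  0 < b <= 1 -> 0 < e -> 0 < T -> 0 <= c -> continuous w ->
  (forall s : R, s <= 0 -> w s = 0) ->
  let z s := w s + c * Num.max s 0 in
  let J t := \int[lebesgue_measure]_(s in `[0, t]) ((t - s) `^ (b - 1) * w s) in
  exists t, [/\ 0 <= t <= T, - (c * e * (b^-1 * T `^ b)) <= J t - J (t - e) &
    exists s s', [/\ t - e <= s <= t, T - e <= s' <= T & z s' <= z s]].
Proof.
move=> b01 e0 T0 c0 cw w0 z J.
have /andP[b0 b1] := b01.
have cmax (x : R) : {for x, continuous (fun y : R => Num.max y 0)}.
  by apply: continuous_max; [exact: cvg_id|exact: cvg_cst].
have cz : continuous z.
  move=> x; apply: cvgD; first exact: cw.
  by apply: cvgM; [exact: cvg_cst|exact: cmax].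
pose a := - e - 1.
pose Z x := \int[lebesgue_measure]_(s in `[a, x]) z s.
have dZ (x : R) : a < x -> is_derive x 1 Z (z x) by exact: is_derive_integral.
pose U x := Z x - Z (x - e).
have dU (x : R) : - 1 < x -> is_derive x 1 U (z x - z (x - e)).
  move=> x1; apply: is_deriveB; first by apply: dZ; rewrite /a; lra.
  have dxe : is_derive x 1 (fun y : R => y - e) 1.
    by apply: is_derive_eq; rewrite subr0.
  have dZe : is_derive (x - e) 1 Z (z (x - e)) by apply: dZ; rewrite /a; lra.
  by have := @is_derive1_comp _ Z (fun y : R => y - e) _ _ _ dZe dxe; rewrite mulr1.
have UE (x : R) : - 1 < x -> exists2 s, x - e <= s <= x & U x = z s * e.
  move=> x1; have xe : x - e < x by lra.
  have [||s + E] := @MVT _ Z z _ _ xe.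
  - by move=> y; rewrite in_itv/= => /andP[? ?]; apply: dZ; rewrite /a; lra.
  - apply: derivable_within_continuous => y; rewrite in_itv/= => /andP[? ?].
    have ay : a < y by rewrite /a; lra.
    by have [] := dZ y ay.
  rewrite in_itv/= => /andP[? ?]; exists s; first by apply/andP; split; lra.
  by rewrite /U E; congr (_ * _); ring.
have [|t + tmax] := @EVT_max _ U 0 T (ltW T0).
  apply: derivable_within_continuous => y; rewrite in_itv/= => /andP[? ?].
  have y1 : - 1 < y by lra.
  by have [] := dU y y1.
rewrite in_itv/= => /andP[t0 tT].
exists t; split; first by rewrite t0.
  (* t is a maximum of U over [0, t], so V below is nonnegative *)
  rewrite /J kernel_convolution_shift ?(ltW e0)//.
  have := @kernel_convolution_shift _ b 0 t w (lexx _) cw w0.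
  rewrite subr0 => ->.
  have [t00|tN0] := eqVneq t 0.
    rewrite t00 set_itv1 !Rintegral_set1 subr0 oppr_le0.
    by rewrite !mulr_ge0 ?powR_ge0 ?invr_ge0 ?(ltW b0) ?(ltW e0).
  have {}t0 : 0 < t by rewrite lt_def tN0.
  pose v s := z (t - s) - z (t - e - s).
  pose V s := U t - U (t - s).
  have reflect_cont (k : R -> R) (x : R) : continuous k ->
      continuous (fun s => k (x - s)).
    move=> ck y; apply: (@continuous_comp _ _ _ (fun s : R => x - s) k); last exact: ck.
    by apply: cvgB; [exact: cvg_cst|exact: cvg_id].
  have cv : continuous v.
    move=> y; apply: cvgB; first exact: (reflect_cont z t cz y).
    exact: (reflect_cont z (t - e) cz y).
  have dV s : 0 <= s <= t -> is_derive s 1 V (v s).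
    move=> /andP[s0 st].
    have dts : is_derive s 1 (fun y : R => t - y) (-1).
      by apply: is_derive_eq; rewrite add0r mul1r.
    have ts1 : -1 < t - s by lra.
    have := @is_derive1_comp _ U (fun y : R => t - y) _ _ _ (dU _ ts1) dts.
    rewrite mulrN1 => dUt.
    apply: (is_derive_eq (is_deriveB (is_derive_cst (U t) s 1) dUt)).
    by rewrite /v (addrAC t (- e)) -[LHS]/(0 - _) sub0r opprK.
  have vle s : v s <= w (t - s) - w (t - e - s) + c * e.
    rewrite /v /z.
    suff : c * Num.max (t - s) 0 - c * Num.max (t - e - s) 0 <= c * e by lra.
    rewrite -mulrBr ler_wpM2l//.
    by rewrite /Num.max; case: ifP; case: ifP; lra.
  have V0 : V 0 = 0 by rewrite /V subr0 subrr.
  have Vge0 s : 0 <= s <= t -> 0 <= V s.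
    move=> /andP[s0 st]; rewrite subr_ge0; apply: tmax.
    by rewrite in_itv/=; apply/andP; split; lra.
  have kpos := powR_kernel_ge0 b01 t0 (continuous_subspaceT cv) dV V0 Vge0.
  have integ (k : R -> R) : continuous k -> (@lebesgue_measure R).-integrable
      `[0, t] (EFin \o (fun s : R => s `^ (b - 1) * k s)).
    by move=> ck; apply: integrable_powR_continuous => //; exact: continuous_subspaceT.
  have i1 := integ _ (reflect_cont w t cw).
  have i2 := integ _ (reflect_cont w (t - e) cw).
  have i3 := integ (fun _ => c * e) (@cst_continuous _ _ _).
  have iv := integ v cv.
  have i12 : (@lebesgue_measure R).-integrable `[0, t] (EFin \o (fun s : R =>
      s `^ (b - 1) * w (t - s) - s `^ (b - 1) * w (t - e - s))).
    rewrite (_ : EFin \o _ = ((EFin \o (fun s : R => s `^ (b - 1) * w (t - s))%R) \-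
      (EFin \o (fun s : R => s `^ (b - 1) * w (t - e - s))%R))%E)//.
    exact: integrableB.
  have i123 : (@lebesgue_measure R).-integrable `[0, t] (EFin \o (fun s : R =>
      s `^ (b - 1) * w (t - s) - s `^ (b - 1) * w (t - e - s)
      + s `^ (b - 1) * (c * e))).
    rewrite (_ : EFin \o _ = ((EFin \o (fun s : R => s `^ (b - 1) * w (t - s)
      - s `^ (b - 1) * w (t - e - s))%R) \+
      (EFin \o (fun s : R => s `^ (b - 1) * (c * e))%R))%E)//.
    exact: integrableD.
  have : \int[lebesgue_measure]_(s in `[0, t]) (s `^ (b - 1) * v s) <=
      \int[lebesgue_measure]_(s in `[0, t]) (s `^ (b - 1) * w (t - s)
        - s `^ (b - 1) * w (t - e - s) + s `^ (b - 1) * (c * e)).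
    apply: le_Rintegral => // s _.
    by rewrite -mulrBr -mulrDr ler_wpM2l ?powR_ge0.
  rewrite RintegralD// RintegralB// RintegralZr//; last exact: integrable_powR.
  have kT : (\int[lebesgue_measure]_(s in `[0, t]) s `^ (b - 1)) * (c * e) <=
      c * e * (b^-1 * T `^ b).
    rewrite mulrC ler_wpM2l ?mulr_ge0 ?(ltW e0)//.
    apply: le_trans (Rintegral_powR_le b0 t0) _.
    by rewrite ler_pM2l ?invr_gt0// ge0_ler_powR ?nnegrE ?(ltW b0) ?(ltW t0) ?(ltW T0).
  lra.
have [s ts Es] := UE t ltac:(lra).
have [s' ts' Es'] := UE T ltac:(lra).
exists s, s'; split => //.
have := tmax T; rewrite in_itv/= lexx (ltW T0) => /(_ isT).
by rewrite Es Es' ler_pM2r.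
Qed.

(** For a = 1 the fractional integral is u - u 0, and a maximum t of z plays the
    role of the window average. *)
Lemma caputo_increment (R : realType) (a : R) : 0 < a <= 1 ->
  exists2 kappa, 0 <= kappa & forall (T c e : R) (u : R -> R),
    0 < T -> 0 <= c -> 0 < e -> {within `[0, +oo[, continuous u} ->
  let z s := u (Num.max s 0) - u 0 + c * Num.max s 0 in
  let Phi := frac_integral (1 - a) (fun s => u s - u 0) in
  exists t, [/\ 0 <= t <= T,
    e <= t -> - (c * e * (kappa * T `^ (1 - a))) <= Phi t - Phi (t - e) &
    exists s s', [/\ t - e <= s <= t, T - e <= s' <= T & z s' <= z s]].
Proof.
move=> /andP[a0 a1].
have cw (u : R -> R) : {within `[0, +oo[, continuous u} ->
    continuous (fun s : R => u (Num.max s 0) - u 0).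
  move=> cu x; apply: cvgB; last exact: cvg_cst.
  exact: (continuous_clip cu).
have [a1E|a1N] := eqVneq a 1.
  exists 1 => // T c e u T0 c0 e0 cu z Phi.
  have cz : continuous z.
    move=> x; apply: cvgD; first exact: (cw u cu x).
    apply: cvgM; first exact: cvg_cst.
    by apply: continuous_max; [exact: cvg_id|exact: cvg_cst].
  have [t + tmax] := @EVT_max _ z 0 T (ltW T0) (continuous_subspaceT cz).
  rewrite in_itv/= => /andP[t0 tT]; exists t; split; first by rewrite t0.
    move=> et; rewrite /Phi /frac_integral a1E subrr eqxx powRr0 !mulr1.
    have : z (t - e) <= z t by apply: tmax; rewrite in_itv/=; apply/andP; split; lra.
    by rewrite /z !max_l; lra.
  exists t, T; split; [lra|lra|].
  by apply: tmax; rewrite in_itv/= lexx ltW.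
have b01 : 0 < 1 - a <= 1.
  by move: a1N; rewrite neq_lt => /orP[|]; lra.
have G0 : 0 <= (Gamma (1 - a))^-1.
  rewrite invr_ge0; apply: Rintegral_ge0 => s _.
  by rewrite mulr_ge0 ?powR_ge0 ?expR_ge0.
exists ((Gamma (1 - a))^-1 * (1 - a)^-1).
  by rewrite mulr_ge0// invr_ge0; lra.
move=> T c e u T0 c0 e0 cu z Phi.
pose w s := u (Num.max s 0) - u 0.
have w0 (s : R) : s <= 0 -> w s = 0.
  by move=> s0; rewrite /w max_r// subrr.
have [t [tT incr ss']] := riemann_liouville_increment b01 e0 T0 c0 (cw u cu) w0.
exists t; split => // _.
have PhiE (x : R) : Phi x = (Gamma (1 - a))^-1 *
    \int[lebesgue_measure]_(s in `[0, x]) ((x - s) `^ (1 - a - 1) * w s).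
  rewrite /Phi /frac_integral gt_eqF; last by case/andP: b01.
  congr (_ * _); apply: eq_Rintegral => s; rewrite inE/= in_itv/= => /andP[s0 _].
  by rewrite /w max_l.
rewrite !PhiE -mulrBr; move: incr.
move: (\int[_]_(_ in _) _ - _) (Gamma _)^-1 G0 (_^-1) (T `^ _) => D G G0 q P incr.
rewrite (_ : - _ = G * - (c * e * (q * P))); last by ring.
by rewrite ler_wpM2l.
Qed.

(** The window supplied by [caputo_increment] is chosen so short that, by uniform
    continuity, z is almost maximal on all of it; the mean value theorem then
    converts the increment of the fractional integral into a value of k. *)
Lemma caputo_max_principle (R : realType) (a : R) : 0 < a <= 1 ->
  exists2 kappa, 0 <= kappa & forall (T c delta : R) (u k : R -> R),
    0 < T -> 0 <= c -> 0 < delta -> {within `[0, +oo[, continuous u} ->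
    (forall t, 0 < t -> is_caputo a u t (k t)) ->
    u 0 < u T + c * T ->
  exists t, [/\ 0 < t <= T, u T + c * T - delta <= u t + c * t &
    - (c * (kappa * T `^ (1 - a))) <= k t].
Proof.
move=> a01; have [kappa kappa0 H] := caputo_increment a01.
exists kappa => // T c delta u k T0 c0 delta0 cu dPhi uT.
pose z (s : R) := u (Num.max s 0) - u 0 + c * Num.max s 0.
have cz : continuous z.
  move=> x; apply: cvgD.
    by apply: cvgB; [exact: (continuous_clip cu)|exact: cvg_cst].
  apply: cvgM; first exact: cvg_cst.
  by apply: continuous_max; [exact: cvg_id|exact: cvg_cst].
have zE (s : R) : 0 <= s -> z s = u s - u 0 + c * s by move=> s0; rewrite /z max_l.
have z0 (s : R) : s <= 0 -> z s = 0.
  by move=> s0; rewrite /z max_r// subrr mulr0 addr0.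
have zT : 0 < z T by rewrite zE ?(ltW T0)//; clear - uT; lra.
pose eta := Num.min delta (z T) / 3.
have eta0 : 0 < eta by rewrite divr_gt0// lt_min delta0.
have etad : 3 * eta <= delta by rewrite /eta mulrC divfK// ge_min lexx.
have etaz : 3 * eta <= z T by rewrite /eta mulrC divfK// ge_min lexx orbT.
have [e' e'0 unif] := @uniform_continuity_segment _ z (-1) T eta cz eta0.
pose e := Num.min e' 1.
have e0 : 0 < e by rewrite lt_min e'0 ltr01.
have ee' : e <= e' by rewrite ge_min lexx.
have e1 : e <= 1 by rewrite ge_min lexx orbT.
have [t [tT incr [s [s' [st s'T zss']]]]] := H T c e u T0 c0 e0 cu.
rewrite -/(z s) -/(z s') in zss'.
(* z is almost maximal on all of [t - e, t], which therefore lies in (0, T] *)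
have zhigh r : t - e <= r <= t -> z T - 2 * eta <= z r.
  move=> rt.
  have h1 : `|z T - z s'| <= eta.
    apply: unif; first by rewrite lexx andbT (le_trans _ (ltW T0))// lerN10.
    by rewrite ler_norml; clear - s'T ee'; lra.
  have h2 : `|z s - z r| <= eta.
    apply: unif.
      by clear - st tT e1; move: st tT => /andP[? ?] /andP[? ?]; apply/andP; split; lra.
    by rewrite ler_norml; clear - st rt ee'; lra.
  move: h1 h2; rewrite !ler_norml => /andP[_ h1] /andP[_ h2].
  by clear - h1 h2 zss'; lra.
have et : e < t.
  rewrite ltNge; apply/negP => te.
  have tet : t - e <= t - e <= t by rewrite lexx lerBlDr lerDl ltW.
  have te0 : t - e <= 0 by rewrite subr_le0.
  have := zhigh _ tet; rewrite (z0 _ te0).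
  by clear - eta0 etaz; lra.
have te : t - e < t by rewrite ltrBlDr ltrDl.
set Phi := frac_integral (1 - a) (fun s => u s - u 0) in incr.
have [||x + E] := @MVT _ Phi k _ _ te.
- move=> y; rewrite in_itv/= => /andP[tey _]; apply: dPhi.
  by apply: lt_trans tey; rewrite subr_gt0.
- apply: derivable_within_continuous => y; rewrite in_itv/= => /andP[tey _].
  have y0 : 0 < y by apply: lt_le_trans tey; rewrite subr_gt0.
  by have [] := dPhi y y0.
rewrite in_itv/= => /andP[tex xt0].
have x0' : 0 < x by apply: lt_trans tex; rewrite subr_gt0.
exists x; split.
- by rewrite x0' (le_trans (ltW xt0))//; case/andP: tT.
- have xt : t - e <= x <= t by rewrite !ltW.
  have := zhigh x xt; rewrite !zE ?(ltW T0) ?(ltW x0')//.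
  clear - etad eta0; lra.
have := incr (ltW et); rewrite E subKr.
have -> : c * e * (kappa * T `^ (1 - a)) = c * (kappa * T `^ (1 - a)) * e by ring.
by rewrite -mulNr ler_pM2r.
Qed.

(** * Eventual bounds for scalar equations *)

(** Suppose u L > c.  The function u(t) + (N / L) t exceeds at L its value at 0,
    because N exceeds M - c.  The maximum principle gives a
    time t where u lies above the line c + N (1 - t / L) and k(t) is larger than
    - eta, once L is large.  Before L / 2 that line lies above M, so t >= T1, and
    the hypothesis on k is contradicted. *)
Lemma caputo_eventually_le (R : realType) (a M c eta T1 : R) (u k : R -> R) :
  0 < a <= 1 -> {within `[0, +oo[, continuous u} ->
  (forall t, 0 < t -> is_caputo a u t (k t)) ->
  (forall t, 0 <= t -> u t <= M) -> 0 < eta ->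
  (forall t, T1 <= t -> c <= u t -> k t <= - eta) ->
  exists L0, forall L, L0 <= L -> u L <= c.
Proof.
move=> a01 cu du uM eta0 kneg.
have [kappa kappa0 maxP] := caputo_max_principle a01.
have /andP[a0 a1] := a01.
pose N := 2 * Num.max (M - c) 0 + 2.
have N0 : 0 < N by rewrite ltr_wpDl// mulr_ge0// le_max lexx orbT.
have NM : 2 * (M - c) < N.
  by rewrite ltr_pwDr// ler_pM2l// le_max lexx.
pose Q := N * kappa / eta + 1.
have Q0 : 0 < Q by rewrite ltr_wpDl// !mulr_ge0// ?invr_ge0 ltW.
exists (Q `^ a^-1 + 2 * `|T1| + 1) => L LL0.
have P0 : 0 <= Q `^ a^-1 by exact: powR_ge0.
have T1n : T1 <= `|T1| by exact: ler_norm.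
have nT1 : 0 <= `|T1| by exact: normr_ge0.
have L0 : 0 < L by clear - LL0 P0 nT1; lra.
have LT1 : 2 * T1 <= L by clear - LL0 P0 nT1 T1n; lra.
have LQ : Q <= L `^ a.
  have : (Q `^ a^-1) `^ a <= L `^ a.
    rewrite ge0_ler_powR ?nnegrE ?(ltW a0) ?(ltW L0)//.
    by clear - LL0 P0 nT1; lra.
  by rewrite -powRrM mulVf ?gt_eqF// powRr1// ltW.
(* the barrier decreases so slowly that its fractional derivative is small *)
have slow : N / L * (kappa * L `^ (1 - a)) < eta.
  rewrite powRB; last by rewrite (gt_eqF L0) implybT.
  rewrite powRr1 ?(ltW L0)//.
  have -> : N / L * (kappa * (L / L `^ a)) = N * kappa / L `^ a.
    by field; rewrite !gt_eqF ?powR_gt0.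
  rewrite ltr_pdivrMr ?powR_gt0// -ltr_pdivrMl// mulrC.
  by apply: lt_le_trans LQ; rewrite ltrDl.
rewrite leNgt; apply/negP => cL.
have uLc : 0 < u L - c by rewrite subr_gt0.
have NL : 0 <= N / L by rewrite divr_ge0 ?ltW.
have NLL : N / L * L = N by rewrite divfK// gt_eqF.
have u0M := uM 0 (lexx _).
have u0 : u 0 < u L + N / L * L.
  rewrite NLL; apply: le_lt_trans u0M _.
  have [McN|Mc] := leP (M - c) 0; first by clear - N0 cL McN; lra.
  by clear - NM cL Mc; lra.
have [t [/andP[t0 tL] ut kt]] := maxP L (N / L) _ u k L0 NL uLc cu du u0.
rewrite NLL in ut.
have uc : c <= u t.
  have : N / L * t <= N / L * L by rewrite ler_wpM2l.
  by rewrite NLL; clear - ut; lra.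
have T1t : T1 <= t.
  rewrite leNgt; apply/negP => tT1.
  have h : N / L * t <= N / 2.
    rewrite -mulrA ler_pM2l// mulrC ler_pdivrMr//.
    by clear - tT1 LT1; lra.
  have := uM t (ltW t0).
  by clear - h ut NM; lra.
by have := kneg t T1t uc; clear - kt slow; lra.
Qed.

(** * Entrywise estimates for the coupled system *)

Lemma normr_entry_le (R : realType) (m n : nat) (M : 'M[R]_(m, n)) i j :
  `|M i j| <= `|M|.
Proof.
rewrite [leRHS]/Num.norm/= mx_normrE.
exact: (@le_bigmax _ _ _ 0 (fun ij : 'I_m * 'I_n => `|M ij.1 ij.2|) (i, j)).
Qed.

Lemma normr_mx_le (R : realType) (m n : nat) (M : 'M[R]_(m, n)) (e : R) :
  0 <= e -> (forall i j, `|M i j| <= e) -> `|M| <= e.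
Proof.
move=> e0 Me; rewrite [leLHS]/Num.norm/= mx_normrE.
by apply: bigmax_le => // ij _.
Qed.

Lemma nonneg_mulmx_le (R : realType) (m n : nat) (M : 'M[R]_(m, n))
    (a b : 'cV[R]_n) (c : R) i :
  (forall i j, 0 <= M i j) -> (forall j, a j 0 <= c * b j 0) ->
  (M *m a) i 0 <= c * (M *m b) i 0.
Proof.
move=> M0 ab; rewrite !mxE mulr_sumr; apply: ler_sum => j _.
by rewrite mulrCA ler_wpM2l.
Qed.

(** The diagonal entry may be negative, so the diagonal term is kept exact. *)
Lemma metzler_mulmx_le (R : realType) (n : nat) (M : 'M[R]_n)
    (a b : 'cV[R]_n) (c : R) i :
  metzler M -> (forall j, a j 0 <= c * b j 0) ->
  (M *m a) i 0 <= c * (M *m b) i 0 + M i i * (a i 0 - c * b i 0).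
Proof.
move=> metM ab; rewrite !mxE (bigD1 i)//= [X in c * X](bigD1 i)//=.
have : \sum_(j | j != i) M i j * a j 0 <= c * \sum_(j | j != i) M i j * b j 0.
  rewrite mulr_sumr; apply: ler_sum => j ji.
  by rewrite mulrCA ler_wpM2l// metM// eq_sym.
have -> : c * (M i i * b i 0 + \sum_(j | j != i) M i j * b j 0) =
  M i i * (c * b i 0) + c * \sum_(j | j != i) M i j * b j 0 by ring.
rewrite mulrBr; lra.
Qed.

Lemma within_continuous_entry (R : realType) (n : nat) (A : set R)
    (x : R -> 'cV[R]_n) i :
  {within A, continuous x} -> {within A, continuous (fun s => x s i 0)}.
Proof.
move=> cx s; apply: (@continuous_comp (subspace A) _ _ x (fun M => M i 0)).
  exact: cx.
exact: coord_continuous.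
Qed.

Lemma vanishing_bounded (R : realType) (n : nat) (u : R -> 'cV[R]_n) :
  {within `[0, +oo[, continuous u} -> u t @[t --> +oo] --> (0 : 'cV[R]_n) ->
  exists2 F, 0 < F & forall t i, 0 <= t -> u t i 0 <= F.
Proof.
move=> cu /cvgr0_norm_le /(_ _ ltr01) [T [_ uT]].
have cuT : {within `[0, `|T| + 1], continuous u}.
  by apply: continuous_subspaceW cu => s /=; rewrite !in_itv/= => /andP[-> _].
have [M M0 uM] := bounded_within_segment cuT.
exists (M + 1); first by rewrite addr_gt0.
move=> t i t0; apply: le_trans (ler_norm _) (le_trans (normr_entry_le _ _ _) _).
have [tT|Tt] := leP t (`|T| + 1).
  by apply: le_trans (uM t _) _; rewrite ?t0// lerDl.
have Tt' : T < t by apply: le_lt_trans (ler_norm _) (lt_trans _ Tt); rewrite ltrDl.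
by apply: le_trans (uT t Tt') _; rewrite lerDr ltW.
Qed.

(** The standing assumptions, bundled with the vectors that witness stability
    with margin [e].  No sign is imposed on the forcing, so that the class is
    closed under changing the sign of a solution and of its forcing. *)
Record dissipative (R : realType) (d n : nat) (S : coupled_system R d n)
    (v : 'cV[R]_d) (w : 'cV[R]_n) (e : R) : Prop := Dissipative {
  dissip_r : 0 < sys_r S;
  dissip_alpha : forall i, 0 < sys_alpha S i <= 1;
  dissip_tau1 : admissible_delay (sys_r S) (sys_tau1 S);
  dissip_tau2 : admissible_delay (sys_r S) (sys_tau2 S);
  dissip_tau3 : admissible_delay (sys_r S) (sys_tau3 S);
  dissip_A : metzler (sys_A S);
  dissip_B : forall i j, 0 <= sys_B S i j;
  dissip_E : forall i j, 0 <= sys_E S i j;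
  dissip_C : forall i j, 0 <= sys_C S i j;
  dissip_D : forall i j, 0 <= sys_D S i j;
  dissip_fc : {within `[0, +oo[, continuous (sys_f S)};
  dissip_gc : {within `[0, +oo[, continuous (sys_g S)};
  dissip_f : sys_f S t @[t --> +oo] --> (0 : 'cV[R]_d);
  dissip_g : sys_g S t @[t --> +oo] --> (0 : 'cV[R]_n);
  dissip_v : forall i, 0 < v i 0;
  dissip_w : forall j, 0 < w j 0;
  dissip_e : 0 < e;
  dissip_drift : forall i,
    (sys_A S *m v + sys_B S *m v + sys_E S *m w) i 0 <= - e;
  dissip_output : forall j, (sys_C S *m v + sys_D S *m w) j 0 <= w j 0 - e
}.

Definition dominated (R : realType) (d n : nat) (v a : 'cV[R]_d)
    (w b : 'cV[R]_n) (m : R) : Prop :=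
  (forall i, a i 0 <= m * v i 0) /\ (forall j, b j 0 <= m * w j 0).

Definition drift (R : realType) (d n : nat) (S : coupled_system R d n)
    (x : R -> 'cV[R]_d) (y : R -> 'cV[R]_n) (t : R) : 'cV[R]_d :=
  sys_A S *m x t + sys_B S *m x (t - sys_tau1 S t)
  + sys_E S *m y (t - sys_tau2 S t) + sys_f S t.

Lemma drift_le (R : realType) (d n : nat) (S : coupled_system R d n) v w e
    (x : R -> 'cV[R]_d) (y : R -> 'cV[R]_n) (m t : R) i :
  dissipative S v w e -> 0 <= m ->
  dominated v (x t) w (y t) m ->
  dominated v (x (t - sys_tau1 S t)) w (y (t - sys_tau1 S t)) m ->
  dominated v (x (t - sys_tau2 S t)) w (y (t - sys_tau2 S t)) m ->
  drift S x y t i 0 <=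
    sys_A S i i * (x t i 0 - m * v i 0) - m * e + sys_f S t i 0.
Proof.
move=> H m0 [xt _] [x1 _] [_ y2]; rewrite /drift 3!mxE lerD2r.
have := metzler_mulmx_le i (dissip_A H) xt.
have := nonneg_mulmx_le i (dissip_B H) x1.
have := nonneg_mulmx_le i (dissip_E H) y2.
have : m * (sys_A S *m v + sys_B S *m v + sys_E S *m w) i 0 <= m * - e.
  by rewrite ler_wpM2l// (dissip_drift H).
rewrite mxE [in X in X -> _]mxE !mulrDr; lra.
Qed.

Lemma output_le (R : realType) (d n : nat) (S : coupled_system R d n) v w e
    (a : 'cV[R]_d) (b : 'cV[R]_n) (m : R) j :
  dissipative S v w e -> 0 <= m ->
  (forall i, a i 0 <= m * v i 0) -> (forall j, b j 0 <= m * w j 0) ->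
  (sys_C S *m a + sys_D S *m b) j 0 <= m * (w j 0 - e).
Proof.
move=> H m0 am bm; rewrite mxE.
have := nonneg_mulmx_le j (dissip_C H) am.
have := nonneg_mulmx_le j (dissip_D H) bm.
have : m * (sys_C S *m v + sys_D S *m w) j 0 <= m * (w j 0 - e).
  by rewrite ler_wpM2l// (dissip_output H).
rewrite mxE mulrDr; lra.
Qed.

(** * Boundedness of solutions *)

Lemma dominated_le (R : realType) (d n : nat) (v a : 'cV[R]_d) (w b : 'cV[R]_n)
    (m m' : R) :
  (forall i, 0 < v i 0) -> (forall j, 0 < w j 0) -> m <= m' ->
  dominated v a w b m -> dominated v a w b m'.
Proof.
move=> v0 w0 mm' [av bw]; split=> i.
  by rewrite (le_trans (av i))// ler_wpM2r// ltW.
by rewrite (le_trans (bw i))// ler_wpM2r// ltW.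
Qed.

Lemma exists_dominated (R : realType) (d n : nat) (v : 'cV[R]_d) (w : 'cV[R]_n)
    (K : R) : (forall i, 0 < v i 0) -> (forall j, 0 < w j 0) -> 0 <= K ->
  exists2 m : R, 0 <= m & forall (a : 'cV[R]_d) (b : 'cV[R]_n),
    (forall i, a i 0 <= K) -> (forall j, b j 0 <= K) -> dominated v a w b m.
Proof.
move=> v0 w0 K0.
have sv : 0 <= \sum_i K / v i 0 by rewrite sumr_ge0// => i _; rewrite divr_ge0// ltW.
have sw : 0 <= \sum_j K / w j 0 by rewrite sumr_ge0// => i _; rewrite divr_ge0// ltW.
exists (\sum_i K / v i 0 + \sum_j K / w j 0); first by rewrite addr_ge0.
move=> a b aK bK; split=> i.
  rewrite (le_trans (aK i))// -ler_pdivrMr// (bigD1 i)//= -addrA lerDl.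
  by rewrite addr_ge0// sumr_ge0// => k _; rewrite divr_ge0// ltW.
rewrite (le_trans (bK i))// -ler_pdivrMr// [X in _ + X](bigD1 i)//= addrCA lerDl.
by rewrite addr_ge0// sumr_ge0// => k _; rewrite divr_ge0// ltW.
Qed.

(** Let q_i be the components divided by the entries of v and w, and suppose that
    the maximum m over [- r, T] of all the q_i exceeds K.  It is attained at a
    positive time.  For a component of y, the output equation bounds q_i strictly
    below m.  For a component of x, the maximum principle with c = 0 gives a time
    where the component is within delta of the level m and its derivative is
    nonnegative, against the drift estimate. *)
Lemma solution_bounded_above (R : realType) (d n : nat) (S : coupled_system R d n)
    v w e psi phi (x : R -> 'cV[R]_d) (y : R -> 'cV[R]_n) :
  dissipative S v w e -> is_solution S psi phi x y ->
  exists2 K, 0 < K & forall t, - sys_r S <= t -> dominated v (x t) w (y t) K.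
Proof.
move=> H [[cx cy] dx yE _].
have v0 := dissip_v H; have w0 := dissip_w H; have e0 := dissip_e H.
have r0 := dissip_r H.
have [F F0 fF] := vanishing_bounded (dissip_fc H) (dissip_f H).
have [G G0 gG] := vanishing_bounded (dissip_gc H) (dissip_g H).
have cseg (V : normedModType R) (u : R -> V) (T : R) :
    {within `[- sys_r S, +oo[, continuous u} ->
    {within `[- sys_r S, T], continuous u}.
  by apply: continuous_subspaceW => s /=; rewrite !in_itv/= => /andP[-> _].
have [M1 M10 xM] := bounded_within_segment (cseg _ x 0 cx).
have [M2 M20 yM] := bounded_within_segment (cseg _ y 0 cy).
have M0 : 0 <= M1 + M2 by rewrite addr_ge0 ?ltW.
have [K0 K00 K0P] := exists_dominated v0 w0 M0.
pose K := K0 + (F + G) / e + 1.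
have FGe : 0 < (F + G) / e by rewrite divr_gt0// addr_gt0.
have Kpos : 0 < K by rewrite /K; clear - K00 FGe; lra.
have init t : - sys_r S <= t <= 0 -> dominated v (x t) w (y t) K.
  move=> t0; apply: (@dominated_le _ _ _ _ _ _ _ K0) => //.
    by rewrite /K; clear - FGe; lra.
  apply: K0P => i; apply: le_trans (ler_norm _) (le_trans (normr_entry_le _ _ _) _).
    by rewrite (le_trans (xM t t0))// lerDl ltW.
  by rewrite (le_trans (yM t t0))// lerDr ltW.
exists K => // T rT.
pose I := ('I_d + 'I_n)%type.
pose q (i : I) (t : R) : R :=
  match i with inl i => x t i 0 / v i 0 | inr j => y t j 0 / w j 0 end.
have cq i : {within `[- sys_r S, T], continuous (q i)}.
  have cM (u : R -> R) (c : R) : {within `[- sys_r S, T], continuous u} ->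
      {within `[- sys_r S, T], continuous (fun s => u s / c)}.
    by move=> cu s; apply: cvgM; [exact: cu|exact: cvg_cst].
  by case: i => i; apply: cM; apply: within_continuous_entry; exact: cseg.
have /choice[c cP] : forall i, exists c, - sys_r S <= c <= T /\
    forall t, - sys_r S <= t <= T -> q i t <= q i c.
  move=> i; have [c ci cmax] := EVT_max rT (cq i).
  by exists c; split; [rewrite in_itv in ci|move=> t tT; apply: cmax; rewrite in_itv].
suff qK : forall i t, - sys_r S <= t <= T -> q i t <= K.
  have TT : - sys_r S <= T <= T by rewrite rT/=.
  by split=> i; rewrite -ler_pdivrMr//; [exact: (qK (inl i))|exact: (qK (inr i))].
suff cK : forall j, q j (c j) <= K.
  by move=> i t tT; exact: le_trans ((cP i).2 t tT) (cK i).
move=> j; rewrite leNgt; apply/negP => Kj.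
have [i0 _ imax] := @Order.TotalTheory.arg_maxP _ _ _ j predT (fun i => q i (c i)) isT.
pose m := q i0 (c i0).
have mK : K < m by apply: lt_le_trans Kj (imax j isT).
have m0 : 0 < m by apply: lt_trans mK.
have meF : F + G < m * e.
  rewrite -ltr_pdivrMr//; apply: le_lt_trans mK; rewrite /K; clear - K00; lra.
have dom t : - sys_r S <= t <= T -> dominated v (x t) w (y t) m.
  move=> tT; split=> i; rewrite -ler_pdivrMr//.
    exact: le_trans ((cP (inl i)).2 t tT) (imax (inl i) isT).
  exact: le_trans ((cP (inr i)).2 t tT) (imax (inr i) isT).
have domtau tau t : admissible_delay (sys_r S) tau -> 0 <= t <= T ->
    dominated v (x (t - tau t)) w (y (t - tau t)) m.
  move=> [_ tau0 taur _] /andP[t0 tT]; apply: dom.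
  by have := tau0 t t0; have := taur t t0; clear - tT; lra.
have ci0 := (cP i0).1.
have c0 : 0 < c i0.
  rewrite ltNge; apply/negP => c0.
  have [h1 h2] : dominated v (x (c i0)) w (y (c i0)) K.
    by apply: init; move: ci0 => /andP[-> _].
  suff : m <= K by rewrite leNgt mK.
  by rewrite /m /q; case: (i0) h1 h2 => i h1 h2; rewrite ler_pdivrMr.
have cT : c i0 <= T by case/andP: ci0.
have mE : q i0 (c i0) = m by [].
move: m mE mK m0 meF dom domtau => m mE mK m0 meF dom domtau.
case: i0 {imax} mE ci0 c0 cT {cP} => i; set t := c _; rewrite /q => mE ci0 t0 tT.
  have {}mE : x t i 0 = m * v i 0 by rewrite -mE divfK// gt_eqF.
  have [kappa _ maxP] := caputo_max_principle (dissip_alpha H i).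
  pose Z := `|sys_A S i i| + 1.
  have Z0 : 0 < Z by rewrite ltr_wpDl.
  pose delta := (m * e - F) / Z.
  have me : 0 < m * e - F by clear - meF G0; lra.
  have delta0 : 0 < delta by rewrite divr_gt0.
  have cxi : {within `[0, +oo[, continuous (fun s => x s i 0)}.
    apply: within_continuous_entry; apply: continuous_subspaceW cx => s /=.
    rewrite !in_itv/= !andbT => s0; by clear - s0 r0; lra.
  have x0t : x 0 i 0 < x t i 0 + 0 * t.
    rewrite mul0r addr0 mE.
    have [h1 _] : dominated v (x 0) w (y 0) K.
      by apply: init; rewrite lexx andbT oppr_le0 ltW.
    by apply: le_lt_trans (h1 i) _; rewrite ltr_pM2r.
  have [s [/andP[s0 st] xs]] :=
    maxP t 0 delta _ (fun s => drift S x y s i 0) t0 (lexx _) delta0 cxi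
      (fun s s0 => dx s s0 i) x0t.
  rewrite mul0r oppr0 => ks; rewrite !mul0r !addr0 in xs.
  have sT : 0 <= s <= T by rewrite (ltW s0) (le_trans st).
  have sT' : - sys_r S <= s <= T.
    by case/andP: sT => s1 ->; rewrite andbT; clear - s1 r0; lra.
  have := drift_le i H (ltW m0) (dom s sT') (domtau _ s (dissip_tau1 H) sT)
    (domtau _ s (dissip_tau2 H) sT).
  have [h1 _] := dom s sT'.
  have fs := fF s i (ltW s0).
  suff : sys_A S i i * (x s i 0 - m * v i 0) < m * e - F.
    by clear - fs ks; lra.
  have xm : 0 <= m * v i 0 - x s i 0 by rewrite subr_ge0 h1.
  have xd : m * v i 0 - x s i 0 <= delta by clear - xs mE; lra.
  apply: le_lt_trans (_ : `|sys_A S i i| * delta < _).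
    rewrite -mulrNN opprB (le_trans (ler_norm _))// normrM normrN (ger0_norm xm).
    by rewrite ler_wpM2l.
  by rewrite /delta mulrA ltr_pdivrMr// mulrC ltr_pM2l// ltrDl.
have {}mE : y t i 0 = m * w i 0 by rewrite -mE divfK// gt_eqF.
have t0T : 0 <= t <= T by rewrite ltW.
have [h1 _] := dom t ci0.
have [_ h2] := domtau _ t (dissip_tau3 H) t0T.
have := output_le i H (ltW m0) h1 h2.
have := gG t i (ltW t0).
have : y t i 0 = (sys_C S *m x t + sys_D S *m y (t - sys_tau3 S t)) i 0 + sys_g S t i 0.
  by rewrite yE ?ltW// [LHS]mxE.
rewrite mE mulrBr; clear - meF F0; lra.
Qed.

(** * Contraction of levels *)

(** The margin e absorbs both the vanishing forcing and the lowering of the level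
    by the proportion sigma, which is chosen small compared with the entries of w
    and the products |a_ii| v_i. *)
Lemma dominated_contraction (R : realType) (d n : nat) (S : coupled_system R d n)
    v w e psi phi (x : R -> 'cV[R]_d) (y : R -> 'cV[R]_n) :
  dissipative S v w e -> is_solution S psi phi x y ->
  exists2 theta, 0 < theta < 1 & forall m, 0 < m ->
    (exists T, forall t, T <= t -> dominated v (x t) w (y t) m) ->
    (exists T, forall t, T <= t -> dominated v (x t) w (y t) (theta * m)).
Proof.
move=> H sol; have [K K0 xK] := solution_bounded_above H sol.
have [[cx cy] dx yE _] := sol.
have v0 := dissip_v H; have w0 := dissip_w H; have e0 := dissip_e H.
have r0 := dissip_r H.
pose W := \sum_j w j 0 + \sum_i `|sys_A S i i| * v i 0.
have sw : 0 <= \sum_j w j 0 by rewrite sumr_ge0// => j _; rewrite ltW.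
have sA : 0 <= \sum_i `|sys_A S i i| * v i 0.
  by rewrite sumr_ge0// => i _; rewrite mulr_ge0// ltW.
have W0 : 0 <= W by rewrite addr_ge0.
pose sigma := e / (4 * (W + e)).
have We : 0 < 4 * (W + e) by rewrite mulr_gt0// ltr_wpDl.
have sigma0 : 0 < sigma by rewrite divr_gt0.
have sigmaW z : z <= W -> sigma * z <= e / 4.
  move=> zW; rewrite /sigma mulrAC ler_pdivrMr// mulrAC -mulrA ler_pM2l//.
  by rewrite mulrC mulrA mulVf// mul1r; clear - zW e0; lra.
have sigma1 : sigma < 1.
  by rewrite /sigma ltr_pdivrMr// mul1r; clear - W0 e0; lra.
have sigmaw j : sigma * w j 0 <= e / 4.
  apply: sigmaW; rewrite /W (bigD1 j)//= -addrA lerDl addr_ge0//.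
  by rewrite sumr_ge0// => k _; rewrite ltW.
have sigmaA i : sigma * (`|sys_A S i i| * v i 0) <= e / 4.
  apply: sigmaW; rewrite /W [X in _ + X](bigD1 i)//= addrCA lerDl addr_ge0//.
  by rewrite sumr_ge0// => k _; rewrite mulr_ge0// ltW.
exists (1 - sigma); first by rewrite subr_gt0 sigma1 gtrBl.
move=> m m0 [T xT].
pose eta := m * e / 4.
have eta0 : 0 < eta by rewrite divr_gt0// mulr_gt0.
have [T1 T1P] : exists T1, forall t, T1 <= t ->
    [/\ 0 < t, T <= t & [/\ T <= t - sys_tau1 S t, T <= t - sys_tau2 S t,
      T <= t - sys_tau3 S t, `|sys_f S t| <= eta & `|sys_g S t| <= eta]].
  have [_ _ _ /cvgryPge lim1] := dissip_tau1 H.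
  have [_ _ _ /cvgryPge lim2] := dissip_tau2 H.
  have [_ _ _ /cvgryPge lim3] := dissip_tau3 H.
  have /cvgr0_norm_le /(_ _ eta0) limf := dissip_f H.
  have /cvgr0_norm_le /(_ _ eta0) limg := dissip_g H.
  suff [N [_ NP]] : \forall t \near +oo, [/\ 0 < t, T <= t &
    [/\ T <= t - sys_tau1 S t, T <= t - sys_tau2 S t,
      T <= t - sys_tau3 S t, `|sys_f S t| <= eta & `|sys_g S t| <= eta]].
    by exists (N + 1) => t Nt; apply: NP; rewrite (lt_le_trans _ Nt)// ltrDl.
  near=> t; split.
  - by near: t; apply: nbhs_pinfty_gt; exact: num_real.
  - by near: t; apply: nbhs_pinfty_ge; exact: num_real.
  - split.
    + by near: t; exact: lim1.
    + by near: t; exact: lim2.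
    + by near: t; exact: lim3.
    + by near: t.
    + by near: t.
have xy t : T1 <= t -> forall j, y t j 0 <= (1 - sigma) * m * w j 0.
  move=> /T1P [t0 Tt [_ _ T3 _ gt]] j.
  have -> : y t j 0 =
      (sys_C S *m x t + sys_D S *m y (t - sys_tau3 S t)) j 0 + sys_g S t j 0.
    by rewrite yE ?ltW// [LHS]mxE.
  have [h1 _] := xT t Tt; have [_ h2] := xT _ T3.
  have := output_le j H (ltW m0) h1 h2.
  have : sys_g S t j 0 <= eta.
    exact: le_trans (ler_norm _) (le_trans (normr_entry_le _ _ _) gt).
  have : m * (sigma * w j 0) <= m * (e / 4) by rewrite ler_pM2l.
  have -> : (1 - sigma) * m * w j 0 = m * w j 0 - m * (sigma * w j 0) by ring.
  have me : 0 < m * e by rewrite mulr_gt0.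
  by rewrite /eta mulrBr !mulrA; clear - me; lra.
have /choice[L LP] : forall i, exists L0, forall t, L0 <= t ->
    x t i 0 <= (1 - sigma) * m * v i 0.
  move=> i.
  have cxi : {within `[0, +oo[, continuous (fun s => x s i 0)}.
    apply: within_continuous_entry; apply: continuous_subspaceW cx => s /=.
    rewrite !in_itv/= !andbT => s0; by clear - s0 r0; lra.
  apply: (@caputo_eventually_le _ _ (K * v i 0) _ eta T1 _
    (fun t => drift S x y t i 0) (dissip_alpha H i) cxi) => //.
  - by move=> t t0; exact: dx.
  - move=> t t0; have [|h _] := xK t; last exact: h.
    by clear - t0 r0; lra.
  move=> t /T1P [t0 Tt [Tt1 Tt2 _ ft _]] cxt.
  have := drift_le i H (ltW m0) (xT t Tt) (xT _ Tt1) (xT _ Tt2).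
  have : sys_f S t i 0 <= eta.
    exact: le_trans (ler_norm _) (le_trans (normr_entry_le _ _ _) ft).
  have [h1 _] := xT t Tt.
  have gap0 : 0 <= m * v i 0 - x t i 0 by rewrite subr_ge0 h1.
  have gap : m * v i 0 - x t i 0 <= sigma * m * v i 0.
    by move: cxt; rewrite !mulrBl mul1r; lra.
  have : sys_A S i i * (x t i 0 - m * v i 0) <= m * (e / 4).
    rewrite -mulrNN opprB (le_trans (ler_norm _))// normrM normrN (ger0_norm gap0).
    apply: (@le_trans _ _ (`|sys_A S i i| * (sigma * m * v i 0))).
      by rewrite ler_wpM2l.
    have -> : `|sys_A S i i| * (sigma * m * v i 0) =
      m * (sigma * (`|sys_A S i i| * v i 0)) by ring.
    by rewrite ler_pM2l.
  have me : 0 < m * e by rewrite mulr_gt0.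
  by rewrite /eta mulrA; clear - me; lra.
exists (`|T1| + \sum_i `|L i|) => t tL.
have sL : 0 <= \sum_i `|L i| by rewrite sumr_ge0.
have T1n : 0 <= `|T1| by exact: normr_ge0.
split=> [i|]; last first.
  apply: xy; apply: le_trans tL; apply: le_trans (ler_norm _) _.
  by rewrite lerDl.
apply: LP; apply: le_trans tL; apply: le_trans (ler_norm _) _.
by rewrite (bigD1 i)//= addrCA lerDl addr_ge0// sumr_ge0.
Unshelve. all: by end_near. Qed.

Lemma solution_limsup_le0 (R : realType) (d n : nat) (S : coupled_system R d n)
    v w e psi phi (x : R -> 'cV[R]_d) (y : R -> 'cV[R]_n) (eps : R) :
  dissipative S v w e -> is_solution S psi phi x y -> 0 < eps ->
  exists T, forall t, T <= t ->
    (forall i, x t i 0 <= eps) /\ (forall j, y t j 0 <= eps).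
Proof.
move=> H sol eps0; have [K K0 xK] := solution_bounded_above H sol.
have [theta /andP[theta0 theta1] contr] := dominated_contraction H sol.
have iter k : exists T, forall t, T <= t ->
    dominated v (x t) w (y t) (theta ^+ k * K).
  elim: k => [|k IH]; first by exists (- sys_r S); rewrite expr0 mul1r.
  rewrite exprS -mulrA; apply: contr => //.
  by rewrite mulr_gt0// exprn_gt0.
have v0 := dissip_v H; have w0 := dissip_w H.
pose W := \sum_i v i 0 + \sum_j w j 0 + 1.
have sv : 0 <= \sum_i v i 0 by rewrite sumr_ge0// => j _; rewrite ltW.
have sw : 0 <= \sum_j w j 0 by rewrite sumr_ge0// => j _; rewrite ltW.
have W0 : 0 < W by rewrite ltr_wpDl// addr_ge0.
have epsKW : 0 < eps / (K * W) by rewrite divr_gt0// mulr_gt0.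
have lim0 : theta ^+ k @[k --> \oo] --> 0.
  by apply: cvg_expr; rewrite ger0_norm ?ltW.
have /cvgr0_norm_le /(_ _ epsKW) [k _ /(_ _ (leqnn k))/= thk] := lim0.
have [T TP] := iter k; exists T => t /TP[xt yt].
have mW : theta ^+ k * K * W <= eps.
  rewrite -mulrA -ler_pdivlMr ?mulr_gt0//.
  exact: le_trans (ler_norm _) thk.
have m0 : 0 <= theta ^+ k * K by rewrite mulr_ge0 ?exprn_ge0 ?ltW.
split=> i.
- apply: le_trans (xt i) (le_trans _ mW); rewrite ler_wpM2l//.
  rewrite /W (bigD1 i)//= -!addrA lerDl !addr_ge0// sumr_ge0// => j _.
  by rewrite ltW.
- apply: le_trans (yt i) (le_trans _ mW); rewrite ler_wpM2l//.
  rewrite /W [\sum_j w j 0](bigD1 i)//= -addrA addrCA -addrA lerDl !addr_ge0//.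
  by rewrite sumr_ge0// => j _; rewrite ltW.
Qed.

Definition opposite_system (R : realType) (d n : nat) (S : coupled_system R d n) :=
  CoupledSystem (sys_r S) (sys_alpha S) (sys_A S) (sys_B S) (sys_E S) (sys_C S)
    (sys_D S) (sys_tau1 S) (sys_tau2 S) (sys_tau3 S)
    (fun t => - sys_f S t) (fun t => - sys_g S t).

Lemma dissipative_opposite (R : realType) (d n : nat) (S : coupled_system R d n)
    v w e : dissipative S v w e -> dissipative (opposite_system S) v w e.
Proof.
move=> [? ? ? ? ? ? ? ? ? ? fc gc f0 g0 ? ? ? ? ?]; split; try assumption.
- by move=> s; apply: cvgN; exact: fc.
- by move=> s; apply: cvgN; exact: gc.
- by rewrite -oppr0; exact: (cvgN f0).
- by rewrite -oppr0; exact: (cvgN g0).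
Qed.

Lemma is_caputoN (R : realType) (a : R) (u : R -> R) (t k : R) :
  is_caputo a u t k -> is_caputo a (fun s => - u s) t (- k).
Proof.
rewrite /is_caputo => du.
have -> : frac_integral (1 - a) (fun s => - u s - - u 0) =
    - frac_integral (1 - a) (fun s => u s - u 0).
  apply/funext => s; rewrite /frac_integral !fctE; case: ifP => _.
    by rewrite opprD.
  rewrite -mulrN -RintegralN; congr (_ * _); apply: eq_Rintegral => z _.
  by rewrite -mulrN opprD.
exact: is_deriveN.
Qed.

Lemma is_solution_opposite (R : realType) (d n : nat) (S : coupled_system R d n)
    psi phi x y : is_solution S psi phi x y ->
  is_solution (opposite_system S) (fun t => - psi t) (fun t => - phi t)
    (fun t => - x t) (fun t => - y t).
Proof.
move=> [[cx cy] dx yE xy0]; split => /=.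
- by split=> s; apply: cvgN; [exact: cx|exact: cy].
- move=> t t0 i; rewrite !mulmxN -!opprD mxE.
  have -> : (fun s => (- x s) i 0) = (fun s => - x s i 0).
    by apply/funext => s; rewrite mxE.
  exact/is_caputoN/dx.
- by move=> t t0; rewrite yE// !mulmxN -!opprD.
- by move=> t t0; have [-> ->] := xy0 t t0.
Qed.

(** * Global attractivity *)

Unset Implicit Arguments.

Theorem theorem5p2 (R : realType) (d n : nat) (r : R) (alpha : 'I_d -> R)
    (A B : 'M[R]_d) (E : 'M[R]_(d, n)) (C : 'M[R]_(n, d)) (D : 'M[R]_n)
    (tau1 tau2 tau3 : R -> R) (f : R -> 'cV[R]_d) (g : R -> 'cV[R]_n)
    (hr : 0 < r)
    (halpha : forall i, 0 < alpha i <= 1)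
    (htau1 : admissible_delay r tau1)
    (htau2 : admissible_delay r tau2)
    (htau3 : admissible_delay r tau3)
    (hA : metzler A)
    (hB : B \is a mxOver Num.nneg)
    (hC : C \is a mxOver Num.nneg)
    (hD : D \is a mxOver Num.nneg)
    (hE : E \is a mxOver Num.nneg)
    (hCrow : forall i : 'I_n, \sum_(k < d) `|C i k| < 1)
    (hDrow : forall i : 'I_n, \sum_(j < n) `|D i j| < 1)
    (hfc : {within `[0, +oo[, continuous f})
    (hgc : {within `[0, +oo[, continuous g})
    (hf0 : forall t, 0 <= t -> f t \is a mxOver Num.nneg)
    (hg0 : forall t, 0 <= t -> g t \is a mxOver Num.nneg)
    (hflim : f t @[t --> +oo] --> (0 : 'cV[R]_d))
    (hglim : g t @[t --> +oo] --> (0 : 'cV[R]_n))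
    (hHurwitz : hurwitz (A + B + E *m invmx (1%:M - D) *m C)) :
  globally_attractive
    (CoupledSystem r alpha A B E C D tau1 tau2 tau3 f g).
Proof.
have nneg p q (M : 'M[R]_(p, q)) : M \is a mxOver Num.nneg -> forall i j, 0 <= M i j.
  by move=> /mxOverP M0 i j; have := M0 i j; rewrite nnegrE.
have Drow i : \sum_j D i j < 1.
  apply: le_lt_trans (hDrow i); apply: ler_sum => j _; exact: ler_norm.
have [v [w [e [v0 w0 e0 drift0 output0]]]] := comparison_vectors hA
  (nneg _ _ _ hB) (nneg _ _ _ hE) (nneg _ _ _ hC) (nneg _ _ _ hD) Drow hHurwitz.
move=> psi phi _ _ _ _ _ x y; set S := CoupledSystem _ _ _ _ _ _ _ _ _ _ _ _ => sol.
have H : dissipative S v w e by split=> //; exact: nneg.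
apply/cvgr0Pnorm_le => eps eps0; rewrite /=.
have [T1 up] := solution_limsup_le0 H sol eps0.
have [T2 low] :=
  solution_limsup_le0 (dissipative_opposite H) (is_solution_opposite sol) eps0.
exists (Num.max T1 T2); split; first exact: num_real.
move=> t; rewrite /= gt_max => /andP[/ltW T1t /ltW T2t].
have [ux uy] := up t T1t; have [lx ly] := low t T2t.
rewrite normr_id; apply: normr_mx_le; first exact: ltW.
move=> i j; rewrite ord1 mxE; case: splitP => k _; rewrite ler_norml lerNl.
  by rewrite ux andbT; have := lx k; rewrite mxE.
by rewrite uy andbT; have := ly k; rewrite mxE.
Qed.
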